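(* For every positive real number $h$, there exists a piecewise monotone interval map $f$ such that its topological entropy satisfies $h_{top}(f)=h$.
   Context: An interval map is a continuous map $f\colon I\to I$ where $I$ is a compact nondegenerate interval of $\mathbb{R}$. It is piecewise monotone if there exists a finite partition of $I$ into intervals such that $f$ is monotone on each element of the partition. $h_{top}(f)$ denotes the topological entropy of $f$. *)

(* Defs.v *)
From HB Require Import structures.
From mathcomp Require Export all_boot all_order all_algebra.
From mathcomp Require Export all_classical all_reals all_analysis.
From mathcomp Require Import unstable.
Export numFieldNormedType.Exports.
Set Implicit Arguments.
Unset Strict Implicit.
Unset Printing Implicit Defensive.
Import Order.TTheory GRing.Theory Num.Theory.
Local Open Scope classical_set_scope.
Local Open Scope ring_scope.

(* Topological entropy in the sense of Adler, Konheim and McAndrew, for the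
   restriction of f to a compact set K with f(K) contained in K. An open cover
   of the space K is represented by a family U of open sets of the ambient
   space whose union contains K: the members of the cover are the traces of the
   members of U on K. *)
Section TopologicalEntropy.
Context {T : topologicalType}.
Implicit Types (K : set T) (f : T -> T) (U : set (set T)).

Definition open_cover K U : Prop :=
  U `<=` open /\ K `<=` \bigcup_(A in U) A.

Definition has_subcover_of_size K U (k : nat) : Prop :=
  exists s : seq (set T),
    [/\ size s = k, [set` s] `<=` U & K `<=` \bigcup_(A in [set` s]) A].

(* N(U); the default value 0 is only used when no finite subfamily of U
   covers K, hence never for an open cover of a compact K. *)
Definition subcover_number K U : nat :=
  xget 0%N [set k | has_subcover_of_size K U k /\
                    forall m, has_subcover_of_size K U m -> (k <= m)%N].

(* U v f^-1(U) v ... v f^-(n-1)(U) *)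
Definition iterated_join f U (n : nat) : set (set T) :=
  [set \bigcap_(j in `I_n) (iter j f @^-1` A j) |
     A in [set A : nat -> set T | forall j, U (A j)]].

Context (R : realType).

(* h(f, U) = lim_n (1/n) log N(U v ... v f^-(n-1)(U)); the limit exists by
   subadditivity when K is compact and f maps K continuously into itself. *)
Definition cover_entropy K f U : R :=
  limn (fun n => ln (subcover_number K (iterated_join f U n))%:R / n%:R).

Definition topological_entropy K f : \bar R :=
  ereal_sup [set (cover_entropy K f U)%:E | U in open_cover K].

End TopologicalEntropy.
Arguments topological_entropy {T} R K f.

Section IntervalMaps.
Context {R : realType}.
Implicit Types (a b : R) (f : R -> R).

(* f is total on R, but only its restriction to [a, b] matters. *)
Definition interval_map a b f : Prop :=
  [/\ a < b, {within `[a, b], continuous f} & set_fun `[a, b] `[a, b] f].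

Definition piecewise_monotone a b f : Prop :=
  exists (n : nat) (J : 'I_n -> set R),
    [/\ partition [set: 'I_n] J `[a, b],
        forall i, is_interval (J i) &
        forall i, monotonic (J i) f].

End IntervalMaps.

(* Main.v *)
Require Import Defs.
From mathcomp Require Import zify ring lra.
Set Implicit Arguments.
Unset Strict Implicit.
Unset Printing Implicit Defensive.
Import Order.TTheory GRing.Theory Num.Theory.
Local Open Scope classical_set_scope.
Local Open Scope ring_scope.

(* The map is [f x = T (beta * x)] on [0, 1], where [T] is the triangle wave of
   period 2 and [beta = expR h]: it has constant slope [+- beta].
   Upper bound: [f] is [beta]-Lipschitz, so an interval of length
   [delta * beta ^- n], with [delta] a Lebesgue number of the cover [U], lies in
   a member of the n-th join; hence the join has a subcover of size
   [O (beta ^ n)].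
   Lower bound: [f] expands distances by exactly [beta] on each lap, so points
   with the same itinerary of length [n] are at distance at most [beta ^- n],
   and there are at least [beta ^ n] itineraries. A sufficiently small neighbourhood
   of a point meets at most three itineraries of length [m], so that a member of
   the (n m)-th join of the cover by such neighbourhoods meets at most [3 ^ n]
   itineraries of length [n m]. This cover therefore has entropy at least
   [h - ln 3 / m], and [m] is arbitrary. *)

(** * Subadditivity and subcover numbers *)

(** Fekete's lemma. Euclidean division of n by m gives a n <= (n %/ m) a m + c with c independent of
    n, so a n / n is eventually at most a m / m plus any positive error. *)
Lemma fekete (R : realType) (a : nat -> R) :
  (forall n, 0 <= a n) -> (forall m n, a (m + n)%N <= a m + a n) ->
  a n / n%:R @[n --> \oo] --> inf [set a n / n%:R | n in [set n | (0 < n)%N]].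
Proof.
move=> a_ge0 aD; set S := [set _ | _ in _].
have S_lb : has_lbound S by exists 0 => _ [n _ <-]; rewrite divr_ge0.
have S_inf : has_inf S by split=> //; exists (a 1%N / 1%:R), 1%N.
have aM k m : a (k * m)%N <= k%:R * a m + a 0%N.
  elim: k => [|k IHk]; first by rewrite mul0n mul0r add0r.
  rewrite mulSn (le_trans (aD _ _)) // -natr1 mulrDl mul1r.
  by rewrite addrAC [leRHS]addrC lerD2l.
have a_le r : a r <= r%:R * a 1%N + a 0%N by rewrite -{1}[r]muln1; exact: aM.
apply/cvgrPdist_le => e e_gt0.
have e2_gt0 : 0 < e / 2 by rewrite divr_gt0.
have [_ [m /= m_gt0 <-] am_lt] := inf_adherent e2_gt0 S_inf.
have m_gt0R : 0 < m%:R :> R by rewrite ltr0n.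
(* [c] bounds together the remainder term a (n %% m) and the extra a 0 coming from [aM]. *)
pose c := m%:R * a 1%N + a 0%N + a 0%N.
have c_ge0 : 0 <= c by rewrite !addr_ge0 // mulr_ge0.
have [N c_lt] : exists N, c / (e / 2) < N%:R.
  by exists (Num.trunc (c / (e / 2))).+1; rewrite truncnS_gt.
near=> n.
have n_gt0 : (0 < n)%N by near: n; exact: nbhs_infty_gt.
have n_gt0R : 0 < n%:R :> R by rewrite ltr0n.
have inf_le_an : inf S <= a n / n%:R by apply: ge_inf => //; exists n.
rewrite distrC ger0_norm ?subr_ge0 // lerBlDl.
have an_le : a n <= (n %/ m)%:R * a m + c.
  rewrite {1}(divn_eq n m) (le_trans (aD _ _)) // /c.
  have := aM (n %/ m)%N m; have := a_le (n %% m)%N.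
  have : (n %% m)%:R * a 1%N <= m%:R * a 1%N.
    by rewrite ler_wpM2r // ler_nat ltnW // ltn_pmod.
  lra.
have c_le : c / n%:R <= e / 2.
  rewrite ler_pdivrMr // mulrC -ler_pdivrMr ?divr_gt0 //.
  rewrite (le_trans (ltW c_lt)) // ler_nat; near: n; exact: nbhs_infty_ge.
have div_le : (n %/ m)%:R * a m / n%:R <= a m / m%:R.
  rewrite ler_pdivrMr // mulrAC ler_pdivlMr // mulrAC [leRHS]mulrC ler_wpM2r //.
  by rewrite -natrM ler_nat leq_divM.
have : a n / n%:R <= (n %/ m)%:R * a m / n%:R + c / n%:R.
  by rewrite -mulrDl ler_wpM2r // invr_ge0.
lra.
Unshelve. all: by end_near. Qed.

Section JoinCovers.
Context {T : topologicalType}.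
Implicit Types (K : set T) (f : T -> T) (U : set (set T)).

Lemma subcover_numberP K U :
  (exists k, has_subcover_of_size K U k) ->
  has_subcover_of_size K U (subcover_number K U) /\
  forall m, has_subcover_of_size K U m -> (subcover_number K U <= m)%N.
Proof.
move=> [k Uk]; rewrite /subcover_number; set P := [set k | _ /\ _].
apply: (@xgetPex _ 0%N P); rewrite /P /=.
have exU : exists k, `[< has_subcover_of_size K U k >] by exists k; apply/asboolP.
case: (ex_minnP exU) => n /asboolP Un n_min; exists n; split=> // m Um.
by apply: n_min; apply/asboolP.
Qed.

Lemma has_subcover_gt0 K U k :
  K !=set0 -> has_subcover_of_size K U k -> (0 < k)%N.
Proof. by move=> [x Kx] [[|A s] [<- _ Us]] //; have [] := Us x Kx. Qed.

Lemma iter_set_fun K f n : set_fun K K f -> set_fun K K (iter n f).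
Proof. by move=> fK x Kx; elim: n => //= n; exact: fK. Qed.

Lemma iterated_joinI f U m n A B :
  iterated_join f U m A -> iterated_join f U n B ->
  iterated_join f U (m + n) (A `&` (iter m f @^-1` B)).
Proof.
move=> [A' UA' <-] [B' UB' <-].
exists (fun j => if (j < m)%N then A' j else B' (j - m)%N).
  by move=> j; case: ifP.
apply/seteqP; split=> [x /= xAB|x [/= xA xB] j /= j_lt].
  split=> [j /= j_lt|j /= j_lt].
    by have := xAB j; rewrite /= j_lt; apply; rewrite ltn_addr.
  have := xAB (m + j)%N.
  by rewrite /= ltn_add2l [(_ < m)%N]ltnNge leq_addr /= addKn addnC iterD; apply.
case: ifPn => [|]; first exact: xA.
rewrite -leqNgt => m_le; have := xB (j - m)%N.
by rewrite /= -iterD subnK //; apply; rewrite ltn_subLR.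
Qed.

Lemma has_subcover_joinD K f U m n k l : set_fun K K f ->
  has_subcover_of_size K (iterated_join f U m) k ->
  has_subcover_of_size K (iterated_join f U n) l ->
  has_subcover_of_size K (iterated_join f U (m + n)) (k * l).
Proof.
move=> fK [s [<- sU sK]] [t [<- tU tK]].
exists [seq A `&` (iter m f @^-1` B) | A <- s, B <- t].
split; first by rewrite size_allpairs.
- move=> _ /= /allpairsP[[A B] /= [As Bt ->]].
  by apply: iterated_joinI; [exact: sU | exact: tU].
- move=> x Kx; have [A /= As Ax] := sK x Kx.
  have [B /= Bt Bx] := tK _ (iter_set_fun m fK Kx).
  exists (A `&` (iter m f @^-1` B)) => //=.
  by apply/allpairsP; exists (A, B).
Qed.

(** * Cover entropy as an infimum *)

Section CoverEntropy.
Context (R : realType) (K : set T) (f : T -> T) (U : set (set T)).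
Hypotheses (K_neq0 : K !=set0) (fK : set_fun K K f).
(** This is what compactness provides. With [K_neq0] it keeps [N n] away from the default value 0,
    so that its logarithm is nonnegative and subadditive. *)
Hypothesis subcover_ex :
  forall n, exists k, has_subcover_of_size K (iterated_join f U n) k.

Let N n := subcover_number K (iterated_join f U n).

Lemma join_number_gt0 n : (0 < N n)%N.
Proof.
by have [+ _] := subcover_numberP (subcover_ex n); exact: has_subcover_gt0.
Qed.

Lemma join_numberD m n : (N (m + n) <= N m * N n)%N.
Proof.
have [_] := subcover_numberP (subcover_ex (m + n)); apply.
have [Nm _] := subcover_numberP (subcover_ex m).
have [Nn _] := subcover_numberP (subcover_ex n).
exact: has_subcover_joinD.
Qed.

Lemma join_numberM m n : (0 < m)%N -> (N (m * n) <= N n ^ m)%N.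
Proof.
case: m => // m _; elim: m => [|m IHm]; first by rewrite mul1n expn1.
by rewrite mulSn expnS (leq_trans (join_numberD _ _)) // leq_mul2l IHm orbT.
Qed.

Lemma cvg_cover_entropy :
  ln ((N n)%:R : R) / n%:R @[n --> \oo] -->
  inf [set ln ((N n)%:R : R) / n%:R | n in [set n | (0 < n)%N]].
Proof.
apply: (@fekete R (fun n => ln (N n)%:R)) => [n|m n].
  by rewrite ln_ge0 // ler1n join_number_gt0.
rewrite -lnM ?posrE ?ltr0n ?join_number_gt0 // ler_ln ?posrE //.
- by rewrite -natrM ler_nat join_numberD.
- by rewrite ltr0n join_number_gt0.
- by rewrite -natrM ltr0n muln_gt0 !join_number_gt0.
Qed.

(** The limit is an infimum, so a single positive [n] already bounds the entropy from above. *)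
Lemma cover_entropy_le n : (0 < n)%N ->
  cover_entropy R K f U <= ln (N n)%:R / n%:R.
Proof.
move=> n_gt0; rewrite /cover_entropy (cvg_lim _ cvg_cover_entropy) //.
apply: ge_inf; last by exists n.
exists 0 => _ [m _ <-]; rewrite divr_ge0 // ln_ge0 // ler1n.
exact: join_number_gt0.
Qed.

Lemma le_cover_entropy (c : R) :
  (forall n, (0 < n)%N -> c <= ln (N n)%:R / n%:R) ->
  c <= cover_entropy R K f U.
Proof.
move=> c_le; rewrite /cover_entropy (cvg_lim _ cvg_cover_entropy) //.
apply: lb_le_inf; first by exists (ln (N 1)%:R / 1%:R), 1%N.
by move=> _ [n n_gt0 <-]; exact: c_le.
Qed.

End CoverEntropy.
End JoinCovers.

(** * Lipschitz maps *)

(** If the ball of radius e at x lies in a member, that member also contains the balls of radius d <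
    e / 2 at all points within e / 2 of x; compactness then makes one d serve all points. *)
Lemma lebesgue_number (R : realType) (X : pseudoMetricType R) (K : set X)
    (U : set (set X)) : compact K -> open_cover K U ->
  exists2 d : R, 0 < d & forall x, K x -> exists2 A, U A & ball x d `<=` A.
Proof.
move=> /compact_near_coveringP K_cov [Uo KU].
have [|d /= d_gt0 Hd] := K_cov R (0^'+)
    (fun d x => exists2 A, U A & ball x d `<=` A) _.
  move=> x Kx; have [A UA Ax] := KU x Kx.
  have /nbhs_ballP[e /= e_gt0 eA] : nbhs x A.
    by apply: open_nbhs_nbhs; split=> //; exact: Uo.
  exists (ball x (e / 2), [set d | d < e / 2]).
    by split; [exact/nbhsx_ballx/divr_gt0 | exact/nbhs_right_lt/divr_gt0].
  move=> [y d] /= [xy d_lt].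
  exists A => // z yz; apply: eA; rewrite [e]splitr.
  exact: ball_triangle xy (le_ball (ltW d_lt) yz).
exists (d / 2); first exact: divr_gt0.
move=> x Kx; apply: (Hd (d / 2)) => //=; last exact: divr_gt0.
by rewrite sub0r normrN gtr0_norm ?divr_gt0 // ltr_pdivrMr //
  mulr_natr mulr2n ltrDl.
Qed.

Lemma lipschitz_iter (R : realType) (f : R -> R) (L : R) :
  0 <= L -> (forall x y, `|f x - f y| <= L * `|x - y|) ->
  forall n x y, `|iter n f x - iter n f y| <= L ^+ n * `|x - y|.
Proof.
move=> L_ge0 fL; elim=> [|n IHn] x y; first by rewrite expr0 mul1r.
by rewrite /= (le_trans (fL _ _)) // exprS -mulrA ler_wpM2l.
Qed.

(** Before time n distances grow by at most L ^+ n, so about L ^+ n / d equally spaced points, d a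
    Lebesgue number, yield a subcover of the join. *)
Lemma lipschitz_subcover (R : realType) (f : R -> R) (L : R) (U : set (set R)) :
  1 <= L -> (forall x y, `|f x - f y| <= L * `|x - y|) ->
  set_fun `[(0 : R), 1] `[(0 : R), 1] f -> open_cover `[(0 : R), 1] U ->
  exists2 C : R, 0 < C & forall n, exists2 k,
    has_subcover_of_size `[(0 : R), 1] (iterated_join f U n) k &
    k%:R <= C * L ^+ n.
Proof.
move=> L_ge1 fL fK Ucov.
have L_ge0 : 0 <= L := le_trans ler01 L_ge1.
have [d d_gt0 Ud] := lebesgue_number (@segment_compact R 0 1) Ucov.
have /choice[F UF] : forall x : R, exists A,
    x \in `[(0 : R), 1] -> U A /\ ball x d `<=` A.
  move=> x; have [Kx|nKx] := pselect (x \in `[(0 : R), 1]); last by exists set0.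
  by have [A UA xA] := Ud x Kx; exists A.
(* The subcover has q + 1 members with q <= L ^+ n / d + 1, and 1 <= L ^+ n absorbs the constant
   2. *)
exists (d^-1 + 2) => [|n]; first by rewrite addr_gt0 ?invr_gt0.
have Ln_ge1 : 1 <= L ^+ n by exact: exprn_ege1.
have Lnd_ge0 : 0 <= L ^+ n / d by rewrite divr_ge0 ?exprn_ge0 // ltW.
pose q := (Num.trunc (L ^+ n / d)).+1.
have q_gt0 : 0 < q%:R :> R by rewrite ltr0n.
have q_gt : L ^+ n / d < q%:R by exact: truncnS_gt.
have q_le : q%:R <= L ^+ n / d + 1.
  by rewrite -natr1 lerD2r; case/andP: (truncn_itv Lnd_ge0).
(* [B i] follows the orbit of the grid point i / q, choosing at each time a member of [U] that
   contains the d-ball around it. *)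
pose B i := \bigcap_(j in `I_n) (iter j f @^-1` F (iter j f (i%:R / q%:R))).
exists q.+1; last by rewrite -natr1; nra.
exists [seq B i | i <- iota 0 q.+1].
split; first by rewrite size_map size_iota.
- move=> _ /mapP[i + ->]; rewrite mem_iota /= ltnS => i_le.
  exists (fun j => F (iter j f (i%:R / q%:R))) => // j.
  apply: (UF _ _).1; apply: (iter_set_fun (K := [set` `[(0 : R), 1]])) => //=.
  by rewrite in_itv /= divr_ge0 //= ler_pdivrMr // mul1r ler_nat.
- move=> x; rewrite [X in X -> _]/= in_itv /= => /andP[x_ge0 x_le1].
  have qx_ge0 : 0 <= q%:R * x by rewrite mulr_ge0.
  have /andP[i_le i_gt] := truncn_itv qx_ge0; set i := Num.trunc _ in i_le i_gt.
  have i_leq : (i <= q)%N.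
    by rewrite -(ler_nat R) (le_trans i_le) // ler_piMr.
  have Bi : B i \in [seq B j | j <- iota 0 q.+1].
    by apply: map_f; rewrite mem_iota ltnS.
  exists (B i); first exact: Bi.
  move=> j /= j_lt; apply: (UF _ _).2.
    apply: (iter_set_fun (K := [set` `[(0 : R), 1]])) => //=.
    by rewrite in_itv /= divr_ge0 //= ler_pdivrMr // mul1r ler_nat.
  rewrite /ball /= (le_lt_trans (lipschitz_iter L_ge0 fL _ _ _)) //.
  rewrite (@le_lt_trans _ _ (L ^+ n * q%:R^-1)) //; last first.
    by rewrite ltr_pdivrMr // mulrC -ltr_pdivrMr.
  apply: ler_pM; rewrite ?exprn_ge0 //; first by rewrite ler_weXn2l // ltnW.
  rewrite distrC ger0_norm; last by rewrite subr_ge0 ler_pdivrMr // mulrC.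
  rewrite -(ler_pM2l q_gt0) mulrBr mulrCA divff ?gt_eqF // mulr1.
  by rewrite lerBlDl natr1 ltW.
Qed.

(** * The triangle wave *)

Lemma odd_absz_succ (k : int) : odd `|k + 1| = ~~ odd `|k|.
Proof. lia. Qed.

Section TriangleWave.
Context {R : realType}.
Implicit Types (t u : R) (k : int).

Definition triangle_wave t : R :=
  let k := Num.floor t in
  if odd `|k| then (k + 1)%:~R - t else t - k%:~R.

Lemma triangle_wave_itv t : 0 <= triangle_wave t <= 1.
Proof.
rewrite /triangle_wave; have := floor_itv t; rewrite intrD /=.
by case: ifP => _ /andP[? ?]; apply/andP; lra.
Qed.

(** The formula extends to the closed lap because those of laps k and k + 1 agree at k + 1. *)
Lemma triangle_wave_affine k t : k%:~R <= t <= (k + 1)%:~R ->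
  triangle_wave t = if odd `|k| then (k + 1)%:~R - t else t - k%:~R.
Proof.
move=> /andP[k_le]; rewrite le_eqVlt => /orP[/eqP ->|t_lt].
  rewrite /triangle_wave intrKfloor odd_absz_succ.
  by case: (odd _); rewrite /= !intrD /=; lra.
by rewrite /triangle_wave (@floor_def _ _ k) ?k_le.
Qed.

Lemma triangle_wave_isometric k t u :
  k%:~R <= t <= (k + 1)%:~R -> k%:~R <= u <= (k + 1)%:~R ->
  `|triangle_wave t - triangle_wave u| = `|t - u|.
Proof.
move=> /triangle_wave_affine -> /triangle_wave_affine ->.
case: ifP => _; first by rewrite distrC; congr `|_|; ring.
by congr `|_|; ring.
Qed.

Lemma floor_itvW t : (Num.floor t)%:~R <= t <= (Num.floor t + 1)%:~R.
Proof. by have /andP[-> /ltW] := floor_itv t. Qed.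

(** On one lap the wave is an isometry; on adjacent laps the distance is split at the common
    integer; otherwise the points are at least 1 apart while the values lie in [0, 1]. *)
Lemma triangle_wave_lipschitz t u :
  `|triangle_wave t - triangle_wave u| <= `|t - u|.
Proof.
wlog tu : t u / t <= u => [wlg|].
  by case: (leP t u) => [/wlg //|/ltW /wlg]; rewrite distrC [`|u - t|]distrC.
have := floor_itvW t; have := floor_itvW u.
set k := Num.floor t; set l := Num.floor u => lu kt.
have : k <= l by exact: le_floor.
rewrite le_eqVlt => /orP[/eqP kl|].
  by rewrite (triangle_wave_isometric kt) ?kl.
rewrite -lezD1 => kl1.
have klR : (k + 1)%:~R <= l%:~R :> R by rewrite ler_int.
have kk : k%:~R <= ((k + 1)%:~R : R) <= (k + 1)%:~R.
  by rewrite lexx andbT ler_int lerDl.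
have ll : l%:~R <= (l%:~R : R) <= (l + 1)%:~R by rewrite lexx /= ler_int lerDl.
have [tk klt] := andP kt; have [lul ull] := andP lu.
have [eq_kl|kl_neq] := eqVneq (k + 1) l.
  have := ler_distD (triangle_wave (k + 1)%:~R)
    (triangle_wave t) (triangle_wave u).
  rewrite (triangle_wave_isometric kt kk) {2}eq_kl
    (triangle_wave_isometric ll lu).
  move=> /le_trans; apply; rewrite -eq_kl in lul *.
  by rewrite !ler0_norm ?subr_le0 //; lra.
have kl2 : (k + 1 + 1)%:~R <= l%:~R :> R.
  by rewrite ler_int lezD1 lt_neqAle kl_neq.
rewrite intrD /= in kl2.
have := triangle_wave_itv t; have := triangle_wave_itv u.
move=> /andP[? ?] /andP[? ?]; rewrite [leRHS]ler0_norm ?subr_le0 //.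
by rewrite ler_norml; apply/andP; lra.
Qed.

(* [s] and [s'] encode sides: [false] is the right and [true] the left. *)
Lemma triangle_wave_germ t (s : bool) :
  exists (e : R) (k : int) (s' : bool), 0 < e /\ forall u, 0 < u < e ->
    Num.floor (t + (-1) ^+ s * u) = k /\
    triangle_wave (t + (-1) ^+ s * u) = triangle_wave t + (-1) ^+ s' * u.
Proof.
suff [e [k [e_gt0 tk tuk]]] : exists e k, [/\ 0 < e,
    k%:~R <= t <= (k + 1)%:~R & forall u, 0 < u < e ->
      k%:~R <= t + (-1) ^+ s * u < (k + 1)%:~R].
  (* Laps of odd index are decreasing and swap the two sides. *)
  exists e, k, (odd `|k| (+) s); split=> // u ue; have tuk' := tuk u ue.
  split; first exact: floor_def.
  rewrite (triangle_wave_affine tk) (@triangle_wave_affine k); last first.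
    by have /andP[-> /ltW] := tuk'.
  by case: (odd _); case: s {tuk tuk'} => /=; rewrite ?expr0 ?expr1; lra.
case: s => /=.
  (* At an integer the left germ lies in the preceding lap, hence the ceiling minus one instead of
     the floor. *)
  exists (t - (Num.ceil t - 1)%:~R), (Num.ceil t - 1).
  have /andP[] := ceil_itv t; rewrite subrK => ? ?; split.
  - by rewrite subr_gt0.
  - by apply/andP; split=> //; exact: ltW.
  - by move=> u /andP[? ?]; rewrite expr1; apply/andP; lra.
exists ((Num.floor t + 1)%:~R - t), (Num.floor t).
have /andP[? ?] := floor_itv t; split.
- by rewrite subr_gt0.
- exact: floor_itvW.
- by move=> u /andP[? ?]; rewrite expr0; apply/andP; lra.
Qed.

End TriangleWave.

(** * Itineraries of the map of constant slope *)

Section ConstantSlope.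
Context {R : realType} (beta : R).
Hypothesis beta_ge1 : 1 <= beta.
Implicit Types (x y u : R) (m n : nat).

Let beta_gt0 : 0 < beta. Proof. exact: lt_le_trans beta_ge1. Qed.

Definition slope_map x : R := triangle_wave (beta * x).

Fixpoint itinerary n x : seq int :=
  if n is m.+1 then Num.floor (beta * x) :: itinerary m (slope_map x) else [::].

Lemma itineraryD m n x :
  itinerary (m + n) x = itinerary m x ++ itinerary n (iter m slope_map x).
Proof. by elim: m x => //= m IHm x; rewrite IHm -iterSr. Qed.

Lemma slope_map_itv x : slope_map x \in `[(0 : R), 1].
Proof. by rewrite in_itv /= triangle_wave_itv. Qed.

Lemma slope_map_set_fun : set_fun `[(0 : R), 1] `[(0 : R), 1] slope_map.
Proof. by move=> x _; exact: slope_map_itv. Qed.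

Lemma slope_map_lipschitz x y :
  `|slope_map x - slope_map y| <= beta * `|x - y|.
Proof.
rewrite (le_trans (triangle_wave_lipschitz _ _)) // -mulrBr normrM.
by rewrite gtr0_norm.
Qed.

Lemma slope_map_continuous : continuous slope_map.
Proof.
move=> x; apply/cvgrPdist_le => e e_gt0; near=> y.
rewrite (le_trans (slope_map_lipschitz _ _)) // mulrC -ler_pdivlMr //.
by near: y; apply: cvgr_dist_le => //; exact: divr_gt0.
Unshelve. all: by end_near. Qed.

(** Equal itineraries keep both points on a common lap at each step, where distances are multiplied
    by exactly [beta]. *)
Lemma itinerary_expanding n x y : itinerary n x = itinerary n y ->
  `|iter n slope_map x - iter n slope_map y| = beta ^+ n * `|x - y|.
Proof.
elim: n x y => [|n IHn] x y; first by rewrite expr0 mul1r.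
case=> xy /IHn; rewrite -!iterSr => ->.
rewrite (triangle_wave_isometric (k := Num.floor (beta * x))); first last.
- by rewrite xy; exact: floor_itvW.
- exact: floor_itvW.
by rewrite -mulrBr normrM gtr0_norm // exprSr mulrA.
Qed.

Lemma itinerary_dist n x y : x \in `[(0 : R), 1] -> y \in `[(0 : R), 1] ->
  itinerary n x = itinerary n y -> `|x - y| <= beta ^- n.
Proof.
move=> xI yI /itinerary_expanding xy.
rewrite -[_ ^- n]mul1r ler_pdivlMr ?exprn_gt0 // mulrC -xy.
have := iter_set_fun n slope_map_set_fun yI.
have := iter_set_fun n slope_map_set_fun xI.
rewrite /= !in_itv /= => /andP[? ?] /andP[? ?].
by rewrite ler_norml; apply/andP; lra.
Qed.

(* With [M = size L], two of the points [i / M], [0 <= i <= M], share an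
   itinerary. *)
Lemma card_itineraries n (L : seq (seq int)) :
  (forall x, x \in `[(0 : R), 1] -> itinerary n x \in L) ->
  beta ^+ n <= (size L)%:R.
Proof.
move=> L_itin; have M_gt0 : (0 < size L)%N.
  have : itinerary n 0 \in L by apply: L_itin; rewrite in_itv /= lexx ler01.
  by case: (L).
have M_gt0R : 0 < (size L)%:R :> R by rewrite ltr0n.
set p := fun i : nat => i%:R / (size L)%:R : R.
have pI i : (i <= size L)%N -> p i \in `[(0 : R), 1].
  by move=> iM; rewrite in_itv /= divr_ge0 //= ler_pdivrMr // mul1r ler_nat.
have [i [j [iM jM ij pij]]] : exists i j, [/\ (i <= size L)%N, (j <= size L)%N,
    (i < j)%N & itinerary n (p i) = itinerary n (p j)].
  apply: contrapT => no_pair.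
  have : uniq [seq itinerary n (p i) | i <- iota 0 (size L).+1].
    rewrite map_inj_in_uniq ?iota_uniq // => i j.
    rewrite !mem_iota /= !ltnS => iM jM pij.
    have [ij|ij|//] := ltngtP i j; by case: no_pair;
      first [by exists i, j | by exists j, i].
  move=> /uniq_leq_size L_ge.
  suff /L_ge : {subset [seq itinerary n (p i) | i <- iota 0 (size L).+1] <= L}.
    by rewrite size_map size_iota ltnn.
  by move=> _ /mapP[i + ->]; rewrite mem_iota ltnS => iM; exact/L_itin/pI.
(* Distinct grid points are at least 1 / M apart, so 1 / M <= beta ^- n. *)
have := itinerary_dist (pI _ iM) (pI _ jM) pij.
rewrite distrC /p -mulrBl -natrB 1?ltnW // normrM !ger0_norm ?invr_ge0 //.
move=> ijM; rewrite -lef_pV2 ?posrE ?exprn_gt0 //.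
by apply: le_trans ijM; rewrite ler_peMl ?invr_ge0 // ler1n subn_gt0.
Qed.

(** A one-sided germ stays in one lap and is mapped to a one-sided germ at the image point, which
    allows induction on [n]. *)
Lemma itinerary_germ n x (s : bool) : exists2 e : R, 0 < e &
  exists w, forall u, 0 < u < e -> itinerary n (x + (-1) ^+ s * u) = w.
Proof.
elim: n x s => [|n IHn] x s; first by exists 1 => //; exists [::].
have [e [k [s' [e_gt0 Hk]]]] := triangle_wave_germ (beta * x) s.
have [e' e'_gt0 [w Hw]] := IHn (slope_map x) s'.
(* Then beta * u is below [e], where the first lap is constant, and below [e'], where the rest of
   the itinerary is. *)
exists (Num.min e e' / beta); first by rewrite divr_gt0 // lt_min e_gt0.
exists (k :: w) => u /andP[u_gt0]; rewrite ltr_pdivlMr // mulrC lt_min.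
move=> /andP[ue ue']; have bu_gt0 : 0 < beta * u by rewrite mulr_gt0.
have [/= |fl tw] := Hk (beta * u); first by rewrite bu_gt0.
by rewrite /= /slope_map mulrDr (mulrCA beta) fl tw Hw // bu_gt0.
Qed.

(* The bound 3 accounts for a point and its two one-sided germs. *)
Definition few_itineraries n : set (set R) := [set A | open A /\
  exists2 L : seq (seq int), (size L <= 3)%N &
    forall x, A x -> itinerary n x \in L].

Lemma few_itineraries_cover n : open_cover `[(0 : R), 1] (few_itineraries n).
Proof.
split=> [A []//|x _].
have [e e_gt0 [w xw]] := itinerary_germ n x false.
have [e' e'_gt0 [w' xw']] := itinerary_germ n x true.
have e_min : 0 < Num.min e e' by rewrite lt_min e_gt0.
exists (ball x (Num.min e e')); last exact: ballxx.
split; first exact: ball_open.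
exists [:: itinerary n x; w; w'] => // y.
rewrite /ball /= lt_min => /andP[xye xye']; rewrite !inE.
case: (ltgtP x y) => [xy|yx|->]; last by rewrite eqxx.
- rewrite -(xw (y - x)) ?expr0 ?mul1r ?subrKC ?eqxx ?orbT //.
  by rewrite subr_gt0 xy -[_ - x]gtr0_norm ?subr_gt0 // distrC.
- rewrite -(xw' (x - y)) ?expr1 ?mulN1r ?opprB ?subrKC ?eqxx ?orbT //.
  by rewrite subr_gt0 yx -[_ - y]gtr0_norm ?subr_gt0.
Qed.

(** The itinerary splits into n blocks of length m; the cover member imposed at the start of a block
    leaves at most three choices for it. *)
Lemma join_itineraries m n A :
  iterated_join slope_map (few_itineraries m) (n * m) A -> (0 < m)%N ->
  exists2 L : seq (seq int), (size L <= 3 ^ n)%N &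
    forall x, A x -> itinerary (n * m) x \in L.
Proof.
move=> [B UB <-] m_gt0; elim: n => [|n [L L_size L_itin]].
  by exists [:: [::]] => // x _; rewrite mul0n inE.
have [_ [L' L'_size L'_itin]] := UB (n * m)%N.
exists [seq v ++ w | v <- L, w <- L'].
  by rewrite size_allpairs expnSr leq_mul.
move=> x xB; rewrite mulSn addnC itineraryD; apply: allpairs_f.
  by apply: L_itin => j /= j_lt; apply: xB; rewrite /= mulSn ltn_addl.
by apply: L'_itin; apply: (xB (n * m)%N); rewrite /= ltn_mul2r m_gt0 /=.
Qed.

(** The lists attached to the k members together contain every itinerary, so [card_itineraries]
    applies to their concatenation. *)
Lemma few_itineraries_subcover m n k : (0 < m)%N ->
  has_subcover_of_size `[(0 : R), 1]
    (iterated_join slope_map (few_itineraries m) (n * m)) k ->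
  beta ^+ (n * m) <= (k * 3 ^ n)%:R.
Proof.
move=> m_gt0 [s [<- sU sK]].
have /choice[L LP] : forall A : set R, exists L : seq (seq int), A \in s ->
    (size L <= 3 ^ n)%N /\ forall x, A x -> itinerary (n * m) x \in L.
  move=> A.
  have [As|nAs] := boolP (A \in s); last by exists [::].
  by have [L ? ?] := join_itineraries (sU _ As) m_gt0; exists L.
pose L' := flatten [seq L A | A <- s].
have L'_size : (size L' <= size s * 3 ^ n)%N.
  rewrite /L'; elim: (s) LP => //= A t IHt LP.
  rewrite size_cat mulSn leq_add //.
    by have [] := LP A (mem_head _ _).
  by apply: IHt => B Bt; apply: LP; rewrite inE Bt orbT.
have L'_itin x : x \in `[(0 : R), 1] -> itinerary (n * m) x \in L'.
  move=> xI; have [A As Ax] := sK x xI; have [_ LA] := LP A As.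
  by apply/flatten_mapP; exists A => //; exact: LA.
by rewrite (le_trans (card_itineraries L'_itin)) // ler_nat.
Qed.

End ConstantSlope.

(** * Entropy of the map of constant slope *)

(** Logarithms give n m h <= m ln a + n ln b, which is divided by n m. It serves with [a] the
    subcover number of the n-th join and b = 3. *)
Lemma ln_growth_rate (R : realType) (h a b : R) (m n : nat) :
  (0 < m)%N -> (0 < n)%N -> 0 < a -> 0 < b ->
  expR h ^+ (n * m) <= a ^+ m * b ^+ n -> h - ln b / m%:R <= ln a / n%:R.
Proof.
move=> m_gt0 n_gt0 a_gt0 b_gt0.
have m_gt0R : 0 < m%:R :> R by rewrite ltr0n.
have n_gt0R : 0 < n%:R :> R by rewrite ltr0n.
move=> hab; have : ln (expR h ^+ (n * m)) <= ln (a ^+ m * b ^+ n).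
  by rewrite ler_ln // posrE ?mulr_gt0 ?exprn_gt0 ?expR_gt0.
rewrite lnM ?posrE ?exprn_gt0 // !lnXn ?expR_gt0 // expRK.
rewrite -[h *+ _]mulr_natr -[_ *+ m]mulr_natr -[_ *+ n]mulr_natr natrM.
move=> {}hab; rewrite ler_pdivlMr // -(ler_pM2r m_gt0R) mulrAC mulrBl.
by rewrite divfK ?gt_eqF //; lra.
Qed.

Section SlopeMapEntropy.
Context {R : realType} (h : R).
Hypothesis h_gt0 : 0 < h.

Let beta := expR h.
Let beta_ge1 : 1 <= beta. Proof. by rewrite -expR0 ler_expR ltW. Qed.

Let unit_neq0 : [set` `[(0 : R), 1]] !=set0.
Proof. by exists 0; rewrite /= in_itv /= lexx ler01. Qed.

Let join_subcover U : open_cover `[(0 : R), 1] U ->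
  forall n, exists k, has_subcover_of_size `[(0 : R), 1]
    (iterated_join (slope_map beta) U n) k.
Proof.
move=> Ucov n; have [C _ /(_ n)[k Uk _]] := lipschitz_subcover beta_ge1
  (slope_map_lipschitz beta_ge1) (slope_map_set_fun beta) Ucov.
by exists k.
Qed.

Lemma slope_map_cover_entropy_le U : open_cover `[(0 : R), 1] U ->
  cover_entropy R `[(0 : R), 1] (slope_map beta) U <= h.
Proof.
move=> Ucov; have [C C_gt0 CU] := lipschitz_subcover beta_ge1
  (slope_map_lipschitz beta_ge1) (slope_map_set_fun beta) Ucov.
apply/ler_addgt0Pr => e e_gt0.
(* For this [n] the constant contributes ln C / n, less than [e]. *)
pose n := (Num.trunc (`|ln C| / e)).+1.
have n_gt0 : 0 < n%:R :> R by rewrite ltr0n.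
have n_ge : `|ln C| / e < n%:R by exact: truncnS_gt.
apply: le_trans (cover_entropy_le R unit_neq0 (slope_map_set_fun beta)
  (join_subcover Ucov) (ltn0Sn _ : (0 < n)%N)) _.
rewrite ler_pdivrMr //.
set N := subcover_number _ _.
have N_gt0 : 0 < N%:R :> R.
  by rewrite ltr0n (join_number_gt0 unit_neq0 (join_subcover Ucov)).
have N_le : N%:R <= C * beta ^+ n.
  have [k Uk k_le] := CU n; apply: le_trans k_le; rewrite ler_nat.
  by have [_] := subcover_numberP (join_subcover Ucov n); exact.
have : ln N%:R <= ln (C * beta ^+ n).
  by rewrite ler_ln ?posrE // mulr_gt0 // exprn_gt0 // expR_gt0.
rewrite lnM ?posrE ?exprn_gt0 ?expR_gt0 // lnXn ?expR_gt0 // expRK -mulr_natr.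
have := ler_norm (ln C); rewrite ltr_pdivrMr // in n_ge.
rewrite mulrDl; lra.
Qed.

(** Counting itineraries bounds the subcover number of the (n m)-th join; [join_numberM] transfers
    the bound to the n-th join, raised to the power m. *)
Lemma le_slope_map_cover_entropy m : (0 < m)%N ->
  h - ln 3 / m%:R <=
    cover_entropy R `[(0 : R), 1] (slope_map beta) (few_itineraries beta m).
Proof.
move=> m_gt0; have Ucov := few_itineraries_cover beta_ge1 m.
apply: (le_cover_entropy unit_neq0 (slope_map_set_fun beta)
  (join_subcover Ucov)) => n n_gt0.
have N_gt0 i := join_number_gt0 unit_neq0 (join_subcover Ucov) i.
have := join_numberM (slope_map_set_fun beta) (join_subcover Ucov) n m_gt0.
have [+ _] := subcover_numberP (join_subcover Ucov (m * n)).
rewrite mulnC => /(few_itineraries_subcover beta_ge1 m_gt0).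
move: (N_gt0 n) (N_gt0 (n * m)%N).
set N := subcover_number _ _; set N' := subcover_number _ _ => N0 N'0 bN NN'.
apply: ln_growth_rate => //; rewrite ?ltr0n //.
apply: (le_trans bN); rewrite natrM !natrX ler_wpM2r ?exprn_ge0 //.
by rewrite -natrX ler_nat.
Qed.

Lemma slope_map_entropy : topological_entropy R `[(0 : R), 1] (slope_map beta) = h%:E.
Proof.
apply/eqP; rewrite eq_le; apply/andP; split.
  apply: ub_ereal_sup => _ [U Ucov <-]; rewrite lee_fin.
  exact: slope_map_cover_entropy_le.
apply/lee_addgt0Pr => e e_gt0; rewrite -leeBlDr // -EFinB.
(* Chosen so that the loss ln 3 / m is at most [e]. *)
pose m := (Num.trunc (ln 3 / e)).+1.
have m_gt0 : 0 < m%:R :> R by rewrite ltr0n.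
have m_gt : ln 3 / e < m%:R by exact: truncnS_gt.
apply: ereal_sup_ge.
exists (cover_entropy R `[(0 : R), 1]
  (slope_map beta) (few_itineraries beta m))%:E.
  by exists (few_itineraries beta m) => //; exact: few_itineraries_cover.
rewrite lee_fin (le_trans _ (le_slope_map_cover_entropy (ltn0Sn _ : (0 < m)%N))) //.
by rewrite lerB // ler_pdivrMr // mulrC -ler_pdivrMr // ltW.
Qed.

End SlopeMapEntropy.

(** * Piecewise monotonicity and conclusion *)

Lemma slope_map_interval_map (R : realType) (beta : R) : 1 <= beta ->
  interval_map 0 1 (slope_map beta).
Proof.
move=> beta_ge1; split; first exact: ltr01.
- exact/continuous_subspaceT/slope_map_continuous.
- exact: slope_map_set_fun.
Qed.

Lemma slope_map_piecewise_monotone (R : realType) (beta : R) : 1 <= beta ->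
  piecewise_monotone 0 1 (slope_map beta).
Proof.
move=> beta_ge1; have beta_gt0 : 0 < beta := lt_le_trans ltr01 beta_ge1.
have bx_ge0 x : 0 <= x -> 0 <= beta * x by move=> ?; rewrite mulr_ge0 // ltW.
pose J i : set R := [set x | x \in `[(0 : R), 1] /\ Num.floor (beta * x) = i%:Z].
(* A partition has nonempty classes: with this count each lap contains i / beta. For integral [beta]
   the last one is the single point 1. *)
exists (Num.trunc beta).+1, (fun i => J i); split.
- split.
  + apply/seteqP; split=> [x [i _ []] //|x xI].
    have := xI; rewrite /= in_itv /= => /andP[x_ge0 x_le1].
    have i_lt : (Num.trunc (beta * x) < (Num.trunc beta).+1)%N.
      by rewrite ltnS; apply: le_truncn; rewrite ler_piMr // ltW.
    exists (Ordinal i_lt) => //; split=> //=.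
    by apply: floor_def; rewrite intrD -!pmulrn natr1 truncn_itv // bx_ge0.
  + by move=> i j _ _ [x [[_ xi] [_]]]; rewrite xi => -[ij]; exact: val_inj.
  + move=> i _; exists (i%:R / beta); split.
      rewrite in_itv /= divr_ge0 /= ?(ltW beta_gt0) // ler_pdivrMr // mul1r.
      rewrite (@le_trans _ _ (Num.trunc beta)%:R) //.
        by rewrite ler_nat -ltnS.
      by have /andP[] := truncn_itv (ltW beta_gt0).
    by rewrite mulrC divfK ?gt_eqF // -[i%:R]/(i%:Z%:~R) intrKfloor.
- move=> i x y [xI xi] [yI yi] z /andP[xz zy]; split.
    move: xI yI; rewrite !in_itv /= => /andP[x0 _] /andP[_ y1].
    by rewrite (le_trans x0) // (le_trans zy).
  (* The floor of beta * z is squeezed between those at [x] and [y], both equal to [i]. *)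
  apply/eqP; rewrite eq_le -{1}yi -xi.
  by rewrite !le_floor // ler_wpM2l // ltW.
- move=> i; have JE x : x \in J i -> slope_map beta x =
      if odd i then i.+1%:R - beta * x else beta * x - i%:R.
    rewrite inE => -[_ xi]; rewrite /slope_map /triangle_wave xi /=.
    by rewrite intrD natr1.
  case: (boolP (odd i)) => odd_i; [right|left] => x y xJ yJ xy;
    by rewrite !JE // ?odd_i ?(negbTE odd_i) ?lerD2l ?lerD2r ?lerN2 ler_pM2l.
Qed.

Theorem corollary4p3 (R : realType) (h : R) (h_gt0 : 0 < h) :
  exists (a b : R) (f : R -> R),
    [/\ interval_map a b f,
        piecewise_monotone a b f &
        topological_entropy R `[a, b] f = h%:E].
Proof.
have beta_ge1 : 1 <= expR h by rewrite -expR0 ler_expR ltW.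
exists 0, 1, (slope_map (expR h)); split.
- exact: slope_map_interval_map.
- exact: slope_map_piecewise_monotone.
- exact: slope_map_entropy.
Qed.
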